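(* Let $s=s(n)$ and $k=k(n)$ be positive integers and $p=p(n)$ a real number such that (i) $\frac{64ks\log n}{\binom{n-1}{k-1}}\le p\le 1$, and (ii) $n\geq 200k^3s$. Then with high probability (i.e. with probability tending to $1$ as $n\to\infty$) the random hypergraph $\mathcal{K}_p(n,k)$ has the following property: every non-trivial $\mathcal{F}\subseteq \mathcal{K}_p(n,k)$ with $\nu(\mathcal{F})\leq s$ satisfies $$|\mathcal{F}|< |\mathcal{K}_p(\hat{S})|$$ for some $S\in \binom{[n]}{s}$.
   Context: $\mathcal{K}_p(n,k)$ denotes the Erdős–Rényi random $k$-uniform hypergraph on vertex set $[n]=\{1,\dots,n\}$, in which each $k$-subset of $[n]$ is included as an edge independently with probability $p$. For a $k$-graph $\mathcal{F}$, $\nu(\mathcal{F})$ (matching number) is the maximum number of pairwise disjoint edges of $\mathcal{F}$, and $\tau(\mathcal{F})$ (covering number) is the minimum size of a vertex set meeting every edge of $\mathcal{F}$. $\mathcal{F}$ is called trivial if $\nu(\mathcal{F})=\tau(\mathcal{F})$ and non-trivial otherwise. For $S\subseteq[n]$, $\mathcal{K}_p(\hat{S})=\{E\in\mathcal{K}_p(n,k)\colon E\cap S\neq\emptyset\}$. $\log$ is the natural logarithm. *)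

(* Defs.v *)
From mathcomp Require Import all_boot all_order all_algebra.

Set Implicit Arguments.
Unset Strict Implicit.
Unset Printing Implicit Defensive.

Section Hypergraph.
Variable T : finType.
Implicit Types (F H M : {set {set T}}) (C S : {set T}).

Definition is_matching F M : bool := (M \subset F) && trivIset M.

Definition matching_number F : nat :=
  (\max_(M : {set {set T}} | is_matching F M) #|M|)%N.

Definition is_vertex_cover F C : bool := [forall e in F, e :&: C != set0].

(* The whole vertex set covers as soon as set0 is not an edge, which holds for
   k-graphs with k > 0; otherwise no cover exists and the value is the junk
   value #|T|. *)
Definition covering_number F : nat :=
  #|[arg min_(C < [set: T] | is_vertex_cover F C) #|C|]%N|.

Definition trivial_hypergraph F : Prop :=
  matching_number F = covering_number F.

(* The paper's K(\hat S). *)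
Definition edges_meeting H S : {set {set T}} := [set e in H | e :&: S != set0].

End Hypergraph.

(* The vertex set [n] is modelled by 'I_n. *)
Definition ksubsets (n k : nat) : {set {set 'I_n}} :=
  [set e : {set 'I_n} | #|e| == k].

Definition nontrivial_subfamilies_small (n s : nat) (H : {set {set 'I_n}}) :
    Prop :=
  forall F : {set {set 'I_n}}, F \subset H ->
    ~ trivial_hypergraph F -> (matching_number F <= s)%N ->
    exists2 S : {set 'I_n}, #|S| = s & (#|F| < #|edges_meeting H S|)%N.

(* Imported only here: all_classical shadows set0, trivIset, etc. of finset. *)
From mathcomp Require Import all_classical all_reals all_analysis.

Import Order.TTheory GRing.Theory Num.Theory.
Import numFieldNormedType.Exports.

Local Open Scope ring_scope.

(* The law of K_p(n, k), i.e. the product over all k-subsets of the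
   Bernoulli(p) laws of their inclusion indicators. *)
Definition random_hypergraph_mass (R : realType) (n k : nat) (p : R)
    (H : {set {set 'I_n}}) : R :=
  \prod_(e in ksubsets n k) (if e \in H then p else 1 - p).

(* The probability that K_p(n, k) satisfies Q. *)
Definition random_hypergraph_prob (R : realType) (n k : nat) (p : R)
    (Q : {set {set 'I_n}} -> Prop) : R :=
  \sum_(H in powerset (ksubsets n k) | `[< Q H >]) random_hypergraph_mass k p H.

(* Main.v *)
(** Write C = binomial(n-1, k-1), X = p C / (k s) >= 64 log n and u = trunc (X / 4).
    With high probability every degree of H exceeds 3 k s u / 2, every codegree
    is at most u, and at most u edges through x meet a given edge e of H that
    avoids x.  For such an H and a non-trivial F inside H with matching number
    at most s, let A be the set of vertices of F-degree larger than s u.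
    A maximum matching of the edges of F avoiding A, of size t, extends greedily
    by one edge through each vertex of A, so #|A| + t is at most the matching
    number of F; and t > 0, since otherwise A is a cover making F trivial.  At
    most t k s u edges of F avoid A, whereas each vertex added to A, up to size
    s, brings more than k s u new edges of H.

    The three typical properties follow from first moments of exponentials:
    the sum Z of the weights exp (count - threshold) over all constraints (with
    the sign reversed for degrees) has expectation at most 22 / n, and Z < 1
    forces every constraint to hold. *)
Require Import Defs.
From mathcomp Require Import all_boot all_order all_algebra.
From mathcomp Require Import zify.

Set Implicit Arguments.
Unset Strict Implicit.
Unset Printing Implicit Defensive.

(** * Matchings, covers and the deterministic bound for non-trivial subfamilies *)

Section Deterministic.
Variable T : finType.
Implicit Types (F H M : {set {set T}}) (A S : {set T}).

(** One notion serves two counts: a singleton [A] gives the codegree of two vertices, and an edge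
    [A] gives the edges through [x] that meet it. *)
Definition edges_through H x A : {set {set T}} :=
  [set f in H | (x \in f) && (f :&: A != set0)].

Definition edges_at H x : {set {set T}} := [set f in H | x \in f].

Definition degree H x := #|edges_at H x|.

Lemma edges_through_subfamily F H x A : F \subset H ->
  edges_through F x A = edges_through H x A :&: F.
Proof.
move=> /subsetP FH; apply/setP => f; rewrite !inE.
by case: (boolP (f \in F)) => [/FH ->|]; rewrite ?andbT ?andbF.
Qed.

Lemma edges_at_subfamily F H x : F \subset H ->
  edges_at F x = edges_at H x :&: F.
Proof.
move=> /subsetP FH; apply/setP => f; rewrite !inE.
by case: (boolP (f \in F)) => [/FH ->|]; rewrite ?andbT ?andbF.
Qed.

Lemma matching_number_ge F M : is_matching F M -> #|M| <= matching_number F.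
Proof. by move=> MF; apply: (@leq_bigmax_cond _ _ (fun M => #|M|)). Qed.

Lemma max_matching_exists F :
  exists2 M, is_matching F M & #|M| = matching_number F.
Proof.
have F0 : is_matching F set0.
  by rewrite /is_matching sub0set; apply/trivIsetP => A B; rewrite inE.
rewrite /matching_number (bigmax_eq_arg _ F0); case: arg_maxnP => // M MF _.
by exists M.
Qed.

Lemma covering_number_le F A : is_vertex_cover F A -> covering_number F <= #|A|.
Proof.
move=> AF; rewrite /covering_number; case: arg_minnP => [|C _]; last exact.
apply/forall_inP => e eF; rewrite setIT.
by apply: contraNneq (forall_inP AF e eF) => ->; rewrite set0I.
Qed.

(** Each edge of a maximum matching contains a vertex of [A]; as the edges are disjoint, choosing
    one such vertex per edge is injective. *)
Lemma matching_number_le_cover F A :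
  is_vertex_cover F A -> matching_number F <= #|A|.
Proof.
move=> AF; have [M /andP [MF tM] <-] := max_matching_exists F.
pose g (e : {set T}) := [pick x in e :&: A].
have gP e : e \in M -> exists2 x, g e = Some x & (x \in e) && (x \in A).
  move=> eM; rewrite /g; case: pickP => [x|e0]; first by rewrite inE; exists x.
  have := forall_inP AF e (subsetP MF _ eM).
  by case/set0Pn => x; rewrite e0.
have gi : {in M &, injective g}.
  move=> e f eM fM ge; have [x ex /andP [xe _]] := gP e eM.
  have [y ey /andP [yf _]] := gP f fM.
  have xy : x = y by apply: Some_inj; rewrite -ex -ey.
  apply/eqP; apply: contraT => ef.
  have /pred0P /(_ x) /= := trivIsetP tM _ _ eM fM ef.
  by rewrite xe xy yf.
rewrite -(card_in_imset gi) -(card_imset (mem A) (@Some_inj _ : injective (@Some T))).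
apply: subset_leq_card; apply/subsetP => _ /imsetP [e eM ->].
have [x -> /andP [_ xA]] := gP e eM.
by apply/imsetP; exists x.
Qed.

(** Without the empty edge the full vertex set is a cover, so the minimum is attained by a genuine
    cover and is not the junk value. *)
Lemma covering_number_ge F : set0 \notin F ->
  matching_number F <= covering_number F.
Proof.
move=> F0; rewrite /covering_number; case: arg_minnP => [|C CF _].
  by apply/forall_inP => e eF; rewrite setIT; apply: contraNneq F0 => <-.
exact: matching_number_le_cover.
Qed.

Lemma card_bigcup_le_mul (I : finType) (P : {set I}) (B : I -> {set {set T}}) u :
  (forall i, i \in P -> #|B i| <= u) -> #|\bigcup_(i in P) B i| <= #|P| * u.
Proof.
move=> Bu; apply: (@leq_trans (\sum_(i in P) #|B i|)).
  elim/big_rec2: _ => [|i m C _ IH]; first by rewrite cards0.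
  by rewrite cardsU; lia.
by rewrite -sum_nat_const; apply: leq_sum.
Qed.

(** Induction on [#|A|], moving one vertex [x] of [A] into the matching at a time. The other
    vertices of [A] and the edges of [M] are at most [s] obstacles, each met by at most [u] edges
    through [x]. Since [x] has degree above [s * u], some edge through [x] avoids them all and joins
    [M]; the sum [#|A| + #|M|] is unchanged. *)
Lemma extend_matching F u s A M :
  (forall x, x \in A -> s * u < degree F x) ->
  (forall x y, x != y -> #|edges_through F x [set y]| <= u) ->
  (forall x e, e \in F -> x \notin e -> #|edges_through F x e| <= u) ->
  is_matching F M -> (forall e, e \in M -> [disjoint e & A]) ->
  #|A| + #|M| <= s.+1 ->
  #|A| + #|M| <= matching_number F.
Proof.
move=> + cod lnk; move: {2}#|A| (erefl #|A|) => m.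
elim: m A M => [|m IH] A M cA dA MF MA.
  by rewrite cA => _; exact: matching_number_ge.
move=> cs; have /card_gt0P [x xA] : 0 < #|A| by rewrite cA.
have cA' : #|A :\ x| = m by move: (cardsD1 x A); rewrite xA cA; lia.
case/andP: MF => MF tM.
have xM e : e \in M -> x \notin e.
  by move=> eM; apply/negP => xe; have /pred0P /(_ x) /= := MA e eM; rewrite xe xA.
pose bad := (\bigcup_(y in A :\ x) edges_through F x [set y]) :|:
  (\bigcup_(e in M) edges_through F x e).
have badle : #|bad| <= s * u.
  apply: leq_trans (leq_card_setU _ _) _.
  have h1 := @card_bigcup_le_mul _ (A :\ x) (fun y => edges_through F x [set y]) u.
  have h2 := @card_bigcup_le_mul _ M (fun e => edges_through F x e) u.
  apply: (@leq_trans (#|A :\ x| * u + #|M| * u)).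
    apply: leq_add; [apply: h1 => y | apply: h2 => e].
      by rewrite !inE => /andP [yx _]; apply: cod; rewrite eq_sym.
    by move=> eM; apply: lnk; [exact: (subsetP MF) | exact: xM].
  by rewrite -mulnDl leq_mul2r cA'; move: cs; rewrite cA; lia.
have /subsetPn [f] : ~~ (edges_at F x \subset bad).
  by apply: contraL (dA x xA) => /subset_leq_card; rewrite -leqNgt /degree; lia.
rewrite !inE => /andP [fF xf] /norP [/bigcupP fA /bigcupP fM].
have fMd e : e \in M -> [disjoint f & e].
  move=> eM; rewrite -setI_eq0; apply/negPn/negP => fe.
  by apply: fM; exists e => //; rewrite inE fF xf.
have fAd : [disjoint f & A :\ x].
  rewrite -setI_eq0; apply/negPn/negP => /set0Pn [y]; rewrite inE => /andP [yf yA].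
  by apply: fA; exists y => //; rewrite inE fF xf; apply/set0Pn; exists y; rewrite !inE yf eqxx.
have fnM : f \notin M by apply/negP => /xM; rewrite xf.
have := IH (A :\ x) (f |: M); rewrite cA' cardsU1 fnM.
have -> : m + (true + #|M|) = #|A| + #|M| by rewrite cA /=; lia.
apply => //.
- by move=> y; rewrite inE => /andP [_]; exact: dA.
- rewrite /is_matching; apply/andP; split.
    by apply/subsetP => e; rewrite !inE => /orP [/eqP -> //|]; exact: (subsetP MF).
  apply/trivIsetP => B C; rewrite !inE => /orP [/eqP -> | BM] /orP [/eqP -> | CM] //.
  + by rewrite eqxx.
  + by move=> _; exact: fMd.
  + by move=> _; rewrite disjoint_sym; exact: fMd.
  + exact: (trivIsetP tM).
- move=> e; rewrite !inE => /orP [/eqP -> // | eM].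
  by apply: disjointWr (MA e eM); exact: subD1set.
Qed.

Lemma edges_meeting_add H A y u : y \notin A ->
  (forall x, x \in A -> #|edges_through H y [set x]| <= u) ->
  #|edges_meeting H A| + degree H y <= #|edges_meeting H (y |: A)| + #|A| * u.
Proof.
move=> yA cod; rewrite /degree.
set P := edges_meeting H A; set Q := edges_at H y.
have -> : edges_meeting H (y |: A) = P :|: Q.
  apply/setP => f; rewrite !inE; case: (f \in H) => //=.
  rewrite setIUr setU_eq0 negb_and orbC; congr (_ || _).
  rewrite setI_eq0 disjoint_sym disjoints1; exact: negbK.
have : #|P :&: Q| <= #|A| * u.
  apply: leq_trans (card_bigcup_le_mul cod).
  apply: subset_leq_card; apply/subsetP => f; rewrite !inE.
  case/andP => /andP [fH /set0Pn [x]]; rewrite inE => /andP [xf xA] /andP [_ yf].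
  apply/bigcupP; exists x => //; rewrite !inE fH yf /=.
  by apply/set0Pn; exists x; rewrite !inE xf eqxx.
have := cardsUI P Q; lia.
Qed.

(** Greedy growth: a new vertex has degree above 3ksu/2, and at most su of its edges already meet
    the current set. As k is at least 2, su is at most ksu/2, which leaves more than ksu new
    edges. *)
Lemma edges_meeting_extend H u k s A m : 1 < k -> s <= #|T| ->
  (forall x, 3 * k * s * u < 2 * degree H x) ->
  (forall x y, x != y -> #|edges_through H x [set y]| <= u) ->
  #|A| + m = s ->
  exists2 S : {set T}, #|S| = s &
    #|edges_meeting H A| + m * (k * s * u).+1 <= #|edges_meeting H S|.
Proof.
move=> k1 sT deg cod; elim: m A => [|m IH] A cA.
  by exists A; [move: cA; rewrite addn0 | rewrite addn0].
have /subsetPn [y _ yA] : ~~ ([set: T] \subset A).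
  by apply/negP => /subset_leq_card; rewrite cardsT; lia.
have cyA : #|y |: A| = #|A|.+1 by rewrite cardsU1 yA.
have [|S cS le] := IH (y |: A); first by rewrite cyA; lia.
exists S => //; apply: leq_trans le.
have := @edges_meeting_add H A y u yA.
have codA x : x \in A -> #|edges_through H y [set x]| <= u.
  by move=> xA; apply: cod; apply: contraNneq yA => ->.
move=> /(_ codA); have := deg y.
have : #|A| * u <= s * u by rewrite leq_mul2r; lia.
have : 2 * (s * u) <= k * s * u by rewrite -mulnA leq_mul2r k1 orbT.
set v := #|A| * u; set w := s * u.
have -> : 3 * k * s * u = 3 * (k * s * u) by rewrite !mulnA.
set z := k * s * u; rewrite mulSn; lia.
Qed.

Lemma nontrivial_subfamily_bound H F k s u : 1 < k -> s <= #|T| ->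
  (forall e, e \in H -> #|e| = k) ->
  (forall x, 3 * k * s * u < 2 * degree H x) ->
  (forall x y, x != y -> #|edges_through H x [set y]| <= u) ->
  (forall x e, e \in H -> x \notin e -> #|edges_through H x e| <= u) ->
  F \subset H -> ~ trivial_hypergraph F -> matching_number F <= s ->
  exists2 S : {set T}, #|S| = s & #|F| < #|edges_meeting H S|.
Proof.
move=> k1 sT unif deg cod lnk FH ntF nuF.
have subE x A : edges_through F x A \subset edges_through H x A.
  by rewrite (edges_through_subfamily _ _ FH) subsetIl.
have codF x y : x != y -> #|edges_through F x [set y]| <= u.
  by move=> /cod; apply: leq_trans; exact: subset_leq_card.
have lnkF x e : e \in F -> x \notin e -> #|edges_through F x e| <= u.
  by move=> /(subsetP FH) /lnk le /le; apply: leq_trans; exact: subset_leq_card.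
pose A := [set x | s * u < degree F x].
pose F' := [set e in F | [disjoint e & A]].
have [M /andP [MF' tM] cM] := max_matching_exists F'.
have MF : is_matching F M.
  rewrite /is_matching tM andbT; apply: subset_trans MF' _.
  by apply/subsetP => e; rewrite inE => /andP [].
have MA e : e \in M -> [disjoint e & A].
  by move=> /(subsetP MF'); rewrite inE => /andP [].
have cMs : #|M| <= s by apply: leq_trans nuF; exact: matching_number_ge.
have cAM : #|A| + #|M| <= matching_number F.
  have [le|gt] := leqP (#|A| + #|M|) s.+1.
    by apply: (@extend_matching F u s) => // x; rewrite inE.
  (* If [A] is too large, keep only s + 1 - [#|M|] of its vertices: the extension would then have s
     + 1 edges, against [matching_number F <= s]. *)
  have : s.+1 - #|M| <= #|A| by lia.
  case/card_geqP => r [ur sr rA]; pose B := [set x in r].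
  have cB : #|B| = s.+1 - #|M| by rewrite cardsE -sr; exact/card_uniqP.
  have BA : B \subset A by apply/subsetP => x; rewrite inE; exact: rA.
  suff : #|B| + #|M| <= matching_number F by lia.
  apply: (@extend_matching F u s) => //; last by lia.
    by move=> x /(subsetP BA); rewrite inE.
  by move=> e eM; apply: disjointWr BA (MA e eM).
(* If [M] is empty, then [A] covers [F], so the covering number is at most [#|A|], hence at most the
   matching number, and [F] is trivial. *)
have M0 : 0 < #|M|.
  rewrite lt0n; apply/negP => /eqP M0; apply: ntF.
  have F0 : set0 \notin F.
    by apply/negP => /(subsetP FH) /unif; rewrite cards0; lia.
  apply/eqP; rewrite eqn_leq covering_number_ge //=.
  apply: leq_trans (covering_number_le _) (leq_trans (leq_addr _ _) cAM).
  apply/forall_inP => e eF; rewrite setI_eq0; apply/negP => eA.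
  have : is_matching F' [set e].
    rewrite /is_matching sub1set inE eF eA /=.
    by apply/trivIsetP => B C; rewrite !inE => /eqP -> /eqP ->; rewrite eqxx.
  by move/matching_number_ge; rewrite cards1 -cM M0.
pose V := cover M.
have cV : #|V| <= #|M| * k.
  rewrite /V /cover -sum_nat_const; apply: leq_trans (leq_card_cover M) _.
  by apply: leq_sum => e /(subsetP MF') ; rewrite inE => /andP [/(subsetP FH) /unif -> _].
(* By maximality of [M], every edge of [F'] meets one of the at most k[#|M|] vertices of [V]. That
   vertex lies outside [A], so its degree in [F] is at most su. *)
have F'le : #|F'| <= #|M| * (k * s * u).
  have : F' \subset \bigcup_(x in V :\: A) edges_at F x.
    apply/subsetP => e eF'; have := eF'; rewrite inE => /andP [eF eA].
    have : ~~ [disjoint e & V].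
      apply/negP => eV.
      have eM : e \notin M.
        apply/negP => eM; move: eV; rewrite -setI_eq0.
        have eVs : e \subset V by exact: (bigcup_sup e).
        by rewrite (setIidPl eVs) -cards_eq0 (unif e (subsetP FH _ eF)); lia.
      have : is_matching F' (e |: M).
        rewrite /is_matching subUset sub1set eF' MF' /=.
        have eMd f : f \in M -> [disjoint e & f].
          by move=> fM; apply: disjointWr eV; exact: (bigcup_sup f).
        apply/trivIsetP => B C; rewrite !inE => /orP [/eqP -> | BM] /orP [/eqP -> | CM] //.
        + by rewrite eqxx.
        + by move=> _; exact: eMd.
        + by move=> _; rewrite disjoint_sym; exact: eMd.
        + exact: (trivIsetP tM).
      by move/matching_number_ge; rewrite cardsU1 eM -cM; lia.
    rewrite -setI_eq0 => /set0Pn [x]; rewrite inE => /andP [xe xV].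
    apply/bigcupP; exists x; last by rewrite inE eF xe.
    rewrite inE xV andbT; apply/negP => xA.
    by move/pred0P: eA => /(_ x) /=; rewrite xe xA.
  move/subset_leq_card => /leq_trans; apply.
  apply: leq_trans (@card_bigcup_le_mul _ _ _ (s * u) _) _.
    by move=> x; rewrite !inE -leqNgt => /andP [].
  rewrite -mulnA [#|M| * _]mulnA; apply: leq_mul => //.
  by apply: leq_trans cV; apply: subset_leq_card; exact: subsetDl.
have Fle : #|F| <= #|edges_meeting H A| + #|F'|.
  apply: leq_trans (leq_card_setU _ _); apply: subset_leq_card.
  apply/subsetP => e eF; rewrite !inE eF (subsetP FH _ eF) /= setI_eq0.
  by case: [disjoint e & A].
have [S cS le] := @edges_meeting_extend H u k s A (s - #|A|) k1 sT deg cod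
  ltac:(lia).
exists S => //; apply: leq_trans le.
(* This uses [#|A| + #|M| <= s]. The [+1] gained per added vertex, together with [0 < #|M|], makes
   the final inequality strict. *)
have : #|M| * (k * s * u).+1 <= (s - #|A|) * (k * s * u).+1.
  by rewrite leq_mul2r; lia.
rewrite mulnS; lia.
Qed.

End Deterministic.

(** * Degrees and codegrees in the complete k-uniform hypergraph *)

Section Counting.
Variables (n k : nat).
Let K := ksubsets n k.

Lemma card_ksubsets : #|K| = 'C(n, k).
Proof. by rewrite card_draws card_ord. Qed.

Lemma card_nonincident_pairs_le :
  #|[pred xe : 'I_n * {set 'I_n} | (xe.2 \in K) && (xe.1 \notin xe.2)]|
    <= n * 'C(n, k).
Proof.
have -> : n * 'C(n, k) = #|setX [set: 'I_n] K|.
  by rewrite cardsX cardsT card_ord card_ksubsets.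
by apply: subset_leq_card; apply/subsetP => -[x e]; rewrite !inE => /andP [].
Qed.

(** Deleting [A] is a bijection onto the subsets of size k - [#|A|] of its complement. *)
Lemma card_ksubsets_containing (A : {set 'I_n}) : #|A| <= k ->
  #|[set e in K | A \subset e]| = 'C(n - #|A|, k - #|A|).
Proof.
move=> Ak; have -> : n - #|A| = #|~: A| by rewrite [RHS]cardsCs setCK card_ord.
rewrite -cards_draws.
have inj : {in [set e in K | A \subset e] &, injective (fun e => e :\: A)}.
  move=> e f; rewrite !inE => /andP [_ Ae] /andP [_ Af] ef.
  by rewrite -(setID e A) -(setID f A) ef (setIidPr Ae) (setIidPr Af).
rewrite -(card_in_imset inj); congr #|pred_of_set _|; apply/setP => g.
apply/imsetP/idP => [[e]|].
  rewrite !inE => /andP [/eqP ce Ae] ->; rewrite setDE subsetIr /=.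
  by rewrite -setDE cardsD (setIidPr Ae) ce.
rewrite !inE => /andP [gA /eqP cg]; exists (g :|: A).
  rewrite !inE subsetUr andbT cardsU.
  have -> : g :&: A = set0.
    by apply/eqP; rewrite setI_eq0 -[A]setCK -subsets_disjoint.
  by rewrite cards0 cg; lia.
apply/setP => x; rewrite !inE; case: (boolP (x \in g)) => [|_] /=.
  by move/(subsetP gA); rewrite inE => ->.
by case: (x \in A).
Qed.

Lemma degree_ksubsets x : 0 < k -> degree K x = 'C(n.-1, k.-1).
Proof.
move=> k0; rewrite -!subn1 -(cards1 x) -card_ksubsets_containing ?cards1 //.
by rewrite /degree; congr #|pred_of_set _|; apply/setP => e; rewrite !inE sub1set.
Qed.

Lemma codegree_ksubsets x y : 1 < k -> x != y ->
  #|edges_through K x [set y]| = 'C(n.-2, k.-2).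
Proof.
move=> k1 xy; have c2 : #|[set x; y]| = 2 by rewrite cards2 xy.
rewrite -!subn2 -c2 -card_ksubsets_containing ?c2 //.
congr #|pred_of_set _|; apply/setP => e; rewrite !inE subUset !sub1set.
case: (#|e| == k) => //=; case: (x \in e) => //=.
apply/set0Pn/idP => [[z]|ye]; first by rewrite !inE => /andP [ze /eqP <-].
by exists y; rewrite !inE ye eqxx.
Qed.

Lemma edges_through_ksubsets_le x (e : {set 'I_n}) : 1 < k -> e \in K -> x \notin e ->
  #|edges_through K x e| <= k * 'C(n.-2, k.-2).
Proof.
move=> k1 eK xe; have -> : k = #|e| by move: eK; rewrite inE => /eqP.
apply: leq_trans (@card_bigcup_le_mul _ _ e
  (fun y => edges_through K x [set y]) _ _).
  apply: subset_leq_card; apply/subsetP => f; rewrite !inE.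
  case/and3P => fK xf /set0Pn [y]; rewrite inE => /andP [yf ye].
  apply/bigcupP; exists y => //; rewrite !inE fK xf /=.
  by apply/set0Pn; exists y; rewrite !inE yf eqxx.
move=> y ye; have ->: #|e| = k by move: eK; rewrite inE => /eqP.
by rewrite codegree_ksubsets //; apply: contraNneq xe => ->.
Qed.

(** The ratio of the two binomials is (n-1)/(k-1), and n - 1 is at least 200k^3s - 1, which exceeds
    (k-1) times 200k^2s. *)
Lemma binomial_ratio_le s : 1 < k -> 0 < s -> 200 * k ^ 3 * s <= n ->
  200 * k ^ 2 * s * 'C(n.-2, k.-2) <= 'C(n.-1, k.-1).
Proof.
move=> k1 s0 nks; have k0 : 0 < k.-1 by lia.
have kk : k.-1 = k.-2.+1 by lia.
have D := mul_bin_diag n.-1 k.-2; rewrite -kk in D.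
rewrite -(leq_pmul2l k0) -D mulnA leq_mul2r; apply/orP; right.
apply: (@leq_trans (200 * k ^ 3 * s).-1); last by lia.
have -> : k ^ 3 = k * k ^ 2 by rewrite expnS.
have : 0 < k ^ 2 * s by rewrite muln_gt0 expn_gt0; lia.
have -> : k.-1 * (200 * k ^ 2 * s) = 200 * (k.-1 * (k ^ 2 * s)) by rewrite !mulnA [k.-1 * 200]mulnC.
have -> : 200 * (k * k ^ 2) * s = 200 * (k * (k ^ 2 * s)) by rewrite !mulnA.
have [j ->] : exists j, k = j.+2 by exists k.-2; lia.
move: (j.+2 ^ 2 * s) => v; rewrite /= !mulSn; lia.
Qed.

End Counting.

Import GRing.Theory Num.Theory.

(** * Generating functions under the product Bernoulli measure *)

Section ProductMeasure.
Local Open Scope ring_scope.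
Variables (I : finType) (K : {set I}).

Lemma sum_powerset_prod (R : comPzRingType) (a b : I -> R) :
  \sum_(H in powerset K) \prod_(e in K) (if e \in H then a e else b e) =
  \prod_(e in K) (a e + b e).
Proof.
(* Extending [a] by 0 and [b] by 1 outside [K] allows expansion over all subsets of [I]: those not
   contained in [K] contribute 0. *)
pose a' e := if e \in K then a e else 0.
pose b' e := if e \in K then b e else 1.
transitivity (\prod_e (a' e + b' e)); last first.
  rewrite [RHS]big_mkcond; apply: eq_bigr => e _.
  by rewrite /a' /b'; case: ifP; rewrite ?add0r.
rewrite bigA_distr [LHS]big_mkcond; apply: eq_bigr => H _; rewrite inE.
case: ifPn => [/subsetP HK | /subsetPn [e eH eK]]; last first.
  by rewrite (bigD1 e) //= eH /a' (negPf eK) mul0r.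
rewrite [LHS]big_mkcond; apply: eq_bigr => e _; rewrite /a' /b'.
by case: ifPn => // eK; case: ifP => // /HK; rewrite (negPf eK).
Qed.

(** By independence the sum factors over [K]: an element of [B] gives pz + 1 - p, one of [E] gives
    p, any other gives 1. Disjointness of [B] and [E] keeps these cases apart. *)
Lemma mgf_weighted (R : comPzRingType) (p z : R) (B E : {set I}) :
  B \subset K -> E \subset K -> [disjoint B & E] ->
  \sum_(H in powerset K) (\prod_(e in K) (if e \in H then p else 1 - p)) *
    ((E \subset H)%:R * z ^+ #|B :&: H|) =
  p ^+ #|E| * (1 + p * (z - 1)) ^+ #|B|.
Proof.
move=> BK EK BE.
pose a e := p * (if e \in B then z else 1).
pose b e := if e \in E then 0 else 1 - p.
have BnE e : e \in B -> e \notin E.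
  by move=> eB; apply/negP => eE; have /pred0P /(_ e) /= := BE; rewrite eB eE.
transitivity (\prod_(e in K) (a e + b e)).
  rewrite -sum_powerset_prod; apply: eq_bigr => H; rewrite inE => /subsetP HK.
  have -> : z ^+ #|B :&: H| = \prod_(e in K) (if e \in B :&: H then z else 1).
    rewrite -big_mkcondr -prodr_const; apply: eq_bigl => e.
    by rewrite inE; case: (boolP (e \in H)) => [/HK ->|]; rewrite ?andbT ?andbF.
  case: (boolP (E \subset H)) => [/subsetP EH | /subsetPn [e eE eH]].
    rewrite mul1r -big_split; apply: eq_bigr => e eK /=; rewrite /a /b !inE.
    case: (boolP (e \in H)) => eH; rewrite ?andbT ?andbF ?mulr1 //.
    by case: ifP => // /EH; rewrite (negPf eH).
  rewrite mul0r mulr0 (bigD1 e) ?(subsetP EK) //=.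
  by rewrite (negPf eH) /b eE mul0r.
rewrite -!prodr_const [in RHS]big_mkcond [X in _ * X]big_mkcond -big_split /=.
rewrite [LHS]big_mkcond; apply: eq_bigr => e _; rewrite /a /b.
case: (boolP (e \in B)) => [eB|eB].
  rewrite (subsetP BK _ eB) (negPf (BnE _ eB)) mul1r mulrBr mulr1.
  by rewrite addrA addrAC addrC addrA.
case: (boolP (e \in E)) => [eE|eE].
  by rewrite (subsetP EK _ eE) mulr1 addr0.
by case: ifP => _; rewrite ?mulr1 // addrC subrK.
Qed.

End ProductMeasure.

From mathcomp Require Import all_classical all_reals all_analysis.
From mathcomp Require Import ring lra.

Import Order.TTheory.
Import numFieldNormedType.Exports.

Local Open Scope ring_scope.

(** * Markov's inequality and exponential moments for the random hypergraph *)

Section RandomHypergraph.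
Variables (R : realType) (n k : nat) (p : R).
Hypotheses (p0 : 0 <= p) (p1 : p <= 1).
Let K := ksubsets n k.
Let mass := random_hypergraph_mass (n := n) k p.

Lemma random_hypergraph_mass_ge0 H : 0 <= mass H.
Proof. by apply: prodr_ge0 => e _; case: ifP => _ //; rewrite subr_ge0. Qed.

Lemma random_hypergraph_mass_sum : \sum_(H in powerset K) mass H = 1.
Proof.
rewrite /mass /random_hypergraph_mass sum_powerset_prod.
by under eq_bigr do rewrite addrC subrK; rewrite big1.
Qed.

Lemma random_hypergraph_prob_le1 (Q : {set {set 'I_n}} -> Prop) :
  random_hypergraph_prob k p Q <= 1.
Proof.
rewrite -random_hypergraph_mass_sum /random_hypergraph_prob.
rewrite [leRHS](bigID (fun H => `[< Q H >])) /= lerDl.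
by apply: sumr_ge0 => H _; exact: random_hypergraph_mass_ge0.
Qed.

(** Markov's inequality at threshold 1: wherever [Q] fails, [Z] is at least 1. *)
Lemma random_hypergraph_markov (Q : {set {set 'I_n}} -> Prop)
    (Z : {set {set 'I_n}} -> R) :
  (forall H, 0 <= Z H) -> (forall H : {set {set 'I_n}}, H \subset K -> Z H < 1 -> Q H) ->
  1 - \sum_(H in powerset K) mass H * Z H <= random_hypergraph_prob k p Q.
Proof.
move=> Z0 ZQ; rewrite -random_hypergraph_mass_sum /random_hypergraph_prob.
rewrite [X in X - _](bigID (fun H => `[< Q H >])) /=.
rewrite lerBlDr lerD2l [leRHS](bigID (fun H => `[< Q H >])) /=.
rewrite -[leLHS]add0r; apply: lerD.
  apply: sumr_ge0 => H _; apply: mulr_ge0 => //.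
  exact: random_hypergraph_mass_ge0.
apply: ler_sum => H /andP [HK /asboolPn nQ].
apply: ler_peMr; first exact: random_hypergraph_mass_ge0.
by rewrite leNgt; apply/negP => /ZQ ZH; apply: nQ; apply: ZH; rewrite -powersetE.
Qed.

(** The generating function at z = e^t, followed by 1 + y <= e^y. *)
Lemma exponential_moment_le (B E : {set {set 'I_n}}) (t c : R) :
  B \subset K -> E \subset K -> [disjoint B & E] ->
  \sum_(H in powerset K) mass H *
    ((E \subset H)%:R * expR (t * #|B :&: H|%:R - c)) <=
  p ^+ #|E| * expR (p * (expR t - 1) * #|B|%:R - c).
Proof.
move=> BK EK BE.
under eq_bigr => H _ do
  rewrite expRD [t * _]mulrC expRM_natl !mulrA -[mass H * _ * _]mulrA.
rewrite -big_distrl /= mgf_weighted // expRD mulrA.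
apply: ler_wpM2r; first exact: expR_ge0.
apply: ler_wpM2l; first exact: exprn_ge0.
rewrite [_ * #|B|%:R]mulrC expRM_natl; apply: lerXn2r; rewrite ?nnegrE ?expR_ge0 //.
  have -> : 1 + p * (expR t - 1) = 1 - p + p * expR t by ring.
  by apply: addr_ge0; [rewrite subr_ge0 | rewrite mulr_ge0 ?expR_ge0].
exact: expR_ge1Dx.
Qed.

End RandomHypergraph.

(** * Numerical bounds on the exponential *)

Section Constants.
Variable R : realType.

Lemma expRN1_le : expR (- 1 : R) <= 1 / 2.
Proof.
have h := expR_ge1Dx (1 : R); have e0 := expR_gt0 (1 : R).
rewrite expRN div1r lef_pV2 ?posrE //; lra.
Qed.

Lemma expR1_le4 : expR (1 : R) <= 4.
Proof.
have h := expR_ge1Dx (- (1 / 2) : R).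
have e0 := expR_gt0 (1 / 2 : R).
have h2 : expR (1 / 2 : R) <= 2.
  have : expR (1 / 2 : R) * expR (- (1 / 2)) = 1 by rewrite expRxMexpNx_1.
  nra.
have -> : (1 : R) = 1 / 2 + 1 / 2 by lra.
rewrite expRD; nra.
Qed.

End Constants.

(** * The non-asymptotic probability bound *)

Lemma expectation_sum (R : realType) (I J : finType) (D : {set J}) (P : pred I)
    (w : J -> R) (f : I -> J -> R) :
  \sum_(H in D) w H * (\sum_(i | P i) f i H) =
  \sum_(i | P i) \sum_(H in D) w H * f i H.
Proof. by under eq_bigr do rewrite big_distrr; rewrite exchange_big. Qed.

Lemma sumr_le_card (R : realType) (I : finType) (P : pred I) (f : I -> R) c :
  (forall i, P i -> f i <= c) -> \sum_(i | P i) f i <= #|P|%:R * c.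
Proof.
by move=> fc; apply: le_trans (ler_sum _ fc) _; rewrite sumr_const mulr_natl.
Qed.

Lemma random_hypergraph_bound (R : realType) (n k s : nat) (p : R) :
  (0 < s)%N -> (0 < k)%N ->
  64 * k%:R * s%:R * ln (n%:R : R) / 'C(n.-1, k.-1)%:R <= p -> p <= 1 ->
  (200 * k ^ 3 * s <= n)%N ->
  1 - 22 / n%:R <=
    random_hypergraph_prob k p (@nontrivial_subfamilies_small n s).
Proof.
move=> s0 k0 pge p1 nks.
have nlarge : (200 * k * s <= n)%N.
  apply: leq_trans nks; rewrite leq_mul2r leq_mul2l; apply/orP; right => /=.
  by rewrite -[leqLHS]expn1 leq_pexp2l.
have n200 : (200 <= n)%N by apply: leq_trans nlarge; rewrite -mulnA leq_pmulr // muln_gt0 k0.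
have kn : (k <= n)%N by apply: leq_trans nlarge; rewrite mulnAC leq_pmull // muln_gt0.
have sn : (s <= n)%N by apply: leq_trans nlarge; rewrite leq_pmull // muln_gt0.
have nR : (200 : R) <= n%:R by rewrite ler_nat.
have n0 : (0 : R) < n%:R by lra.
set L := ln (n%:R : R) in pge.
have nL : n%:R = expR L by rewrite lnK.
have L1 : 1 <= L.
  by rewrite -ler_expR -nL; apply: le_trans (expR1_le4 R) _; lra.
set C := 'C(n.-1, k.-1) in pge.
have C0 : (0 : R) < C%:R by rewrite ltr0n bin_gt0; lia.
have kR : (1 : R) <= k%:R by rewrite ler1n.
have sR : (1 : R) <= s%:R by rewrite ler1n.
have ks1 : (1 : R) <= k%:R * s%:R by rewrite -natrM ler1n muln_gt0 k0.
rewrite ler_pdivrMr // in pge.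
(* For k = 1 the binomial is 1 and the lower bound on [p] would exceed 1. *)
have k1 : (1 < k)%N.
  rewrite ltn_neqAle k0 andbT eq_sym; apply/negP => /eqP kE.
  move: pge; rewrite /C kE bin0 !mulr1; nra.
have p0 : 0 <= p.
  rewrite -(pmulr_lge0 _ C0); apply: le_trans pge.
  by rewrite !mulr_ge0 //; lra.
have k2 : (2 : R) <= k%:R by rewrite ler_nat.
pose X : R := p * C%:R / (k%:R * s%:R).
have dX : p * C%:R = X * (k%:R * s%:R) by rewrite /X divfK //; lra.
have X64 : 64 * L <= X by rewrite /X ler_pdivlMr; lra.
have ks2 : (2 : R) <= k%:R * s%:R by nra.
have d2X : 2 * X <= p * C%:R by rewrite dX; have : 0 <= X * (k%:R * s%:R - 2); [apply: mulr_ge0; lra | lra].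
pose K := ksubsets n k.
pose term (B E : {set {set 'I_n}}) (t c : R) (H : {set {set 'I_n}}) : R :=
  (E \subset H)%:R * expR (t * #|B :&: H|%:R - c).
have term0 B E t c H : 0 <= term B E t c H by rewrite mulr_ge0 ?expR_ge0.
(* The degree threshold is 3pC/8, which equals (3/2)ks(X/4) and so is at least 3ksu/2. *)
pose Z1 H := \sum_(x : 'I_n) term (edges_at K x) finset.set0 (-1) (- (3 / 8 * (p * C%:R))) H.
pose Z2 H := \sum_(xy : 'I_n * 'I_n | xy.1 != xy.2)
  term (edges_through K xy.1 [set xy.2]%SET) finset.set0 1 (X / 4) H.
(* Only edges [xe.2] present in [H] count; this indicator contributes a factor [p] to the
   expectation. *)
pose Z3 H := \sum_(xe : 'I_n * {set 'I_n} | (xe.2 \in K) && (xe.1 \notin xe.2))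
  term (edges_through K xe.1 xe.2) [set xe.2]%SET 1 (X / 4) H.
have Z10 H : 0 <= Z1 H by exact: sumr_ge0.
have Z20 H : 0 <= Z2 H by exact: sumr_ge0.
have Z30 H : 0 <= Z3 H by exact: sumr_ge0.
have edges_throughK x A : edges_through K x A \subset K.
  by apply/fintype.subsetP => f; rewrite inE => /andP [].
have edges_atK x : edges_at K x \subset K.
  by apply/fintype.subsetP => f; rewrite inE => /andP [].
set w : R := expR (- (X / 16)).
have w0 : 0 < w := expR_gt0 _.
set D : R := 'C(n.-2, k.-2)%:R.
have D0 : 0 <= D by [].
have cod_le : p * (k%:R * D) <= X / 200.
  rewrite ler_pdivlMr // /X ler_pdivlMr; last by lra.
  have := binomial_ratio_le k1 s0 nks; rewrite -(ler_nat R) !natrM -/C -/D.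
  by move/(ler_wpM2l p0); lra.
have X0 : 0 < X by lra.
(* As e - 1 <= 3, the exponent is at most 3X/200 - X/4. *)
have moment_le (m : nat) : m%:R <= k%:R * D ->
    p * (expR 1 - 1) * m%:R - X / 4 <= - (X / 5).
  move=> /(ler_wpM2l p0) mD; have pm0 : 0 <= p * m%:R by rewrite mulr_ge0.
  have e4 := expR1_le4 R.
  have : p * m%:R * (expR 1 - 1) <= p * m%:R * 3 by apply: ler_wpM2l => //; lra.
  lra.
(* As e^(-1) <= 1/2, each exponent is at most -pC/2 + 3pC/8 = -pC/8, and pC >= 2X. *)
have B1 : \sum_(H in powerset K) random_hypergraph_mass k p H * Z1 H <= n%:R * w.
  rewrite expectation_sum -[n in leRHS]card_ord; apply: sumr_le_card => x _.
  apply: le_trans (exponential_moment_le p0 p1 _ _ _ _ _) _ => //.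
  - exact: finset.sub0set.
  - by rewrite disjoint_sym -setI_eq0 finset.set0I.
  rewrite cards0 mul1r ler_expR -/(degree K x) degree_ksubsets // -/C.
  have := expRN1_le R; nra.
have B2 : \sum_(H in powerset K) random_hypergraph_mass k p H * Z2 H <= n%:R ^+ 2 * w.
  rewrite expectation_sum; apply: (@le_trans _ _ (#|[pred xy : 'I_n * 'I_n | xy.1 != xy.2]|%:R * w)).
    apply: sumr_le_card => -[x y] /= xy.
    apply: le_trans (exponential_moment_le p0 p1 _ _ _ _ _) _ => //.
    + exact: finset.sub0set.
    + by rewrite disjoint_sym -setI_eq0 finset.set0I.
    rewrite cards0 mul1r ler_expR codegree_ksubsets //.
    apply: le_trans (moment_le _ _) _; last by lra.
    by rewrite -/D ler_peMl.
  rewrite ler_pM2r // -natrX ler_nat; apply: leq_trans (max_card _) _.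
  by rewrite card_prod card_ord.
(* There may be far more than polynomially many pairs, but the factor [p] reduces their weight to n
   times p binomial(n, k) = nXs. Part of the exponential absorbs X, and s <= n. *)
have B3 : \sum_(H in powerset K) random_hypergraph_mass k p H * Z3 H <= 20 * n%:R ^+ 3 * w.
  rewrite expectation_sum; apply: (@le_trans _ _ (#|[pred xe : 'I_n * {set 'I_n} |
      (xe.2 \in K) && (xe.1 \notin xe.2)]|%:R * (p * expR (- (X / 5))))).
    apply: sumr_le_card => -[x e] /= /andP [eK xe].
    apply: le_trans (exponential_moment_le p0 p1 _ _ _ _ _) _ => //.
    + by rewrite finset.sub1set.
    + by rewrite disjoint_sym disjoints1 inE (negPf xe) andbF.
    rewrite cards1 expr1 ler_wpM2l // ler_expR.
    apply: moment_le; rewrite /D -natrM ler_nat.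
    exact: edges_through_ksubsets_le.
  have cle : #|[pred xe : 'I_n * {set 'I_n} |
      (xe.2 \in K) && (xe.1 \notin xe.2)]|%:R <= n%:R * 'C(n, k)%:R :> R.
    by rewrite -natrM ler_nat; exact: card_nonincident_pairs_le.
  have pC : p * 'C(n, k)%:R = n%:R * X * s%:R.
    have : (n%:R * C%:R = k%:R * 'C(n, k)%:R :> R).
      by rewrite -!natrM /C mul_bin_diag prednK.
    move=> nC; apply: (@mulfI _ k%:R); first by rewrite pnatr_eq0 -lt0n.
    by rewrite mulrCA -nC mulrCA dX; ring.
  (* Split off e^(-X/20), for which X e^(-X/20) <= 20; the remaining e^(-3X/20) is at most [w]. *)
  have XE : X * expR (- (X / 5)) <= 20 * w.
    have := expR_ge1Dx (X / 20) => hX.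
    have -> : - (X / 5) = - (X / 20) + - (3 * X / 20) by field.
    rewrite expRD expRN mulrA; apply: ler_pM; rewrite ?expR_ge0 //.
    - by rewrite mulr_ge0 ?invr_ge0 ?expR_ge0 //; lra.
    - by rewrite ler_pdivrMr ?expR_gt0 //; lra.
    - by rewrite ler_expR; lra.
  have sn' : s%:R <= n%:R :> R by rewrite ler_nat.
  apply: (@le_trans _ _ (n%:R * 'C(n, k)%:R * (p * expR (- (X / 5))))).
    by apply: ler_wpM2r cle; rewrite mulr_ge0 ?expR_ge0.
  have -> : n%:R * 'C(n, k)%:R * (p * expR (- (X / 5))) =
      n%:R ^+ 2 * (X * expR (- (X / 5))) * s%:R.
    have -> : n%:R * 'C(n, k)%:R * (p * expR (- (X / 5))) =
      n%:R * (p * 'C(n, k)%:R) * expR (- (X / 5)) by ring.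
    by rewrite pC; ring.
  have -> : 20 * n%:R ^+ 3 * w = n%:R ^+ 2 * (20 * w) * n%:R by ring.
  apply: ler_pM => //.
    by rewrite !mulr_ge0 ?expR_ge0 ?exprn_ge0 //; lra.
  by apply: ler_wpM2l => //; rewrite exprn_ge0.
(* This is where the constant 64 enters: X/16 >= 4 log n. *)
have wn : w * n%:R ^+ 4 <= 1.
  rewrite nL -expRM_natl -expRD -[leRHS]expR0 ler_expR; lra.
apply: le_trans (random_hypergraph_markov (Z := fun H => Z1 H + Z2 H + Z3 H) p0 p1 _ _).
- under eq_bigr do rewrite !mulrDr.
  rewrite !big_split /= lerD2l lerN2.
  apply: le_trans (lerD (lerD B1 B2) B3) _.
  rewrite ler_pdivlMr //; set N : R := n%:R in nR wn *.
  have h1 : N * N <= N ^+ 4 by rewrite -expr2 ler_weXn2l //; lra.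
  have h2 : N ^+ 2 * N <= N ^+ 4 by rewrite -exprSr ler_weXn2l //; lra.
  have h3 : N ^+ 3 * N = N ^+ 4 by rewrite -exprSr.
  move: (ler_wpM2l (ltW w0) h1) (ler_wpM2l (ltW w0) h2) => {}h1 {}h2.
  have -> : (N * w + N ^+ 2 * w + 20 * N ^+ 3 * w) * N =
    w * (N * N) + w * (N ^+ 2 * N) + 20 * (w * (N ^+ 3 * N)) by ring.
  rewrite h3; lra.
- by move=> H; rewrite !addr_ge0.
move=> H HK Zlt F FH ntF nuF.
have Z1lt : Z1 H < 1 by have := Z20 H; have := Z30 H; lra.
have Z2lt : Z2 H < 1 by have := Z10 H; have := Z30 H; lra.
have Z3lt : Z3 H < 1 by have := Z10 H; have := Z20 H; lra.
(* Counts are integers, so a count below X/4 is at most [u]. *)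
pose u := Num.trunc (X / 4).
have uX : u%:R <= X / 4 by rewrite truncn_le; lra.
have le_u (m : nat) : m%:R <= X / 4 -> (m <= u)%N.
  by move=> mX; rewrite truncn_ge_nat //; lra.
apply: (@nontrivial_subfamily_bound _ H F k s u) => //.
- by rewrite card_ord.
- by move=> e /(fintype.subsetP HK); rewrite inE => /eqP.
- move=> x; rewrite -(ltr_nat R) !natrM.
  have : term (edges_at K x) finset.set0 (-1) (- (3 / 8 * (p * C%:R))) H < 1.
    apply: le_lt_trans Z1lt; rewrite /Z1 (bigD1 x) //= lerDl.
    exact: sumr_ge0.
  rewrite /term finset.sub0set mul1r -edges_at_subfamily // expR_lt1.
  rewrite -/(degree H x) dX => dlt.
  have : k%:R * s%:R * u%:R <= k%:R * s%:R * (X / 4) :> R by apply: ler_wpM2l => //; lra.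
  lra.
- move=> x y xy; apply: le_u.
  have : term (edges_through K x [set y]%SET) finset.set0 1 (X / 4) H < 1.
    apply: le_lt_trans Z2lt; rewrite /Z2 (bigD1 (x, y)) //= lerDl.
    exact: sumr_ge0.
  rewrite /term finset.sub0set !mul1r -edges_through_subfamily // expR_lt1.
  lra.
- move=> x e eH xe; apply: le_u.
  have : term (edges_through K x e) [set e]%SET 1 (X / 4) H < 1.
    apply: le_lt_trans Z3lt; rewrite /Z3 (bigD1 (x, e)) /= ?lerDl; last first.
      by rewrite xe andbT; exact: (fintype.subsetP HK).
    exact: sumr_ge0.
  rewrite /term finset.sub1set eH !mul1r -edges_through_subfamily // expR_lt1.
  lra.
Qed.

(** * Passage to the limit *)

Local Open Scope classical_set_scope.

Theorem theorem1p3 (R : realType) (s k : nat -> nat) (p : nat -> R)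
  (s_gt0 : forall n, (0 < s n)%N)
  (k_gt0 : forall n, (0 < k n)%N)
  (p_bounds : \forall n \near \oo,
     64 * (k n)%:R * (s n)%:R * ln (n%:R : R) / 'C(n.-1, (k n).-1)%:R <= p n
     /\ p n <= 1)
  (n_large : \forall n \near \oo, (200 * k n ^ 3 * s n <= n)%N) :
  (fun n : nat => random_hypergraph_prob (k n) (p n)
     (@nontrivial_subfamilies_small n (s n))) @ \oo --> (1 : R).
Proof.
have lim : (fun n : nat => 1 - 22 / n%:R : R) @ \oo --> (1 : R).
  rewrite -[X in _ --> X]subr0 -[X in _ - X](mulr0 22).
  apply: cvgB; first exact: cvg_cst.
  (* The harmonic sequence is 1/(n+1), hence the shift. *)
  apply: cvgMr; rewrite -cvg_shiftS; exact: cvg_harmonic.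
apply: (squeeze_cvgr _ lim); last exact: cvg_cst.
near=> n.
have [pge ple] : 64 * (k n)%:R * (s n)%:R * ln (n%:R : R) / 'C(n.-1, (k n).-1)%:R <= p n
     /\ p n <= 1 by near: n.
have nks : (200 * k n ^ 3 * s n <= n)%N by near: n.
rewrite random_hypergraph_bound //= random_hypergraph_prob_le1 //.
apply: le_trans pge; apply: divr_ge0 => //; apply: mulr_ge0; first by rewrite !mulr_ge0.
(* At n = 0 the logarithm has the default value 0, so the lower bound on [p] is non-negative there
   too. *)
case: (posnP n) => [->|n0]; first by rewrite ln0.
by rewrite ln_ge0 // ler1n.
Unshelve. all: by end_near.
Qed.
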